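(* A constant exposure fund (or group of funds acting as one) with a target constant proportional exposure of $\kappa$ to a decomposable derivative security that trades in the market with a standard maturity of $T$ years, having a linear market impact model that increases the implied mark of all derivative securities by $\lambda$ for each unit of exposure purchased, will, at time $t+\Delta t$, have capital $C_{t+\Delta t}$, average maturity $M_{t+\Delta t}$, and implied mark $\sigma_{t+\Delta t}$ given jointly by $$C_{t+\Delta t} = C_t + \frac{C_t\kappa\Delta t\left(R_{t;t+\Delta t}-\sigma_{t+\Delta t} + C_t\kappa\lambda\frac{(M_t-\Delta t)}{M_t}\right)}{M_t - C_t\kappa^2\lambda(M_t-\Delta t)},$$ $$M_{t+\Delta t} = \frac{M_t T\Delta t\left[\kappa\left(\sigma_t-R_{t;t+\Delta t}\right)-1\right] - (M_t-\Delta t)^2\left(M_t - C_t\kappa^2\lambda(M_t-\Delta t)\right)}{C_t\kappa^2\lambda(M_t-\Delta t)^2 - M_t\left(M_t-\kappa\Delta t\left(\sigma_t-R_{t;t+\Delta t}\right)\right)},$$ $$\sigma_{t+\Delta t} = \frac{\sigma_t M_t + C_t\kappa\lambda\left(\Delta t-\kappa\sigma_t M_t+\kappa\Delta t R_{t;t+\Delta t}\right)}{C_t\kappa^2\lambda(M_t-\Delta t)-M_t},$$ where $R_{t;t+\Delta t}$ is the realized portion of the derivative for the period from time $t$ to time $t+\Delta t$ and $C_0$ is the fund's initial starting capital.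
   Context: Here $C_t$, $M_t$, $\sigma_t$ denote the fund's capital, the average maturity of its position, and the implied mark at time $t$; $\Delta t$ is the time step. Definitions. A standard maturity derivative security is one that is typically traded in the market for a fixed maturity of a particular number of years (here $T$). A decomposable derivative security is one whose payoff can be expressed as $\sum_{t=0}^{T-\Delta t}\frac{N\Delta t}{T}\left(R_{t;t+\Delta t}-K\right)$, where the security has initial strike $K$ and notional $N$ and pays off $N(R_{0;T}-K)$ at maturity $T$, with $R_{A;B}$ representing the realized value of the period from $A$ to $B$. A linear market impact model for a family of derivative securities with a flat term structure adjusts all future implied values by the same amount for a given amount of notional traded; in particular, for a variance swap, $\sigma'=\sigma+\lambda V$, where $\sigma'$ is the new implied level, $\sigma$ is the old implied level, $V$ is the amount of variance swap notional purchased (negative if sold), and $\lambda$ is the impact. A constant exposure fund is one that seeks to maintain an exposure to a standard maturity derivative equal to a fixed proportion (here $\kappa$) of its capital at every period. Model relations. These assumptions, together with the definition of profit as realized profit plus implied profit, are expressed by the following equations, where $V_t$ is the exposure (''vega'') at time $t$, $\tilde V_t$ is the ''aged'' exposure remaining after time $\Delta t$ has elapsed, and $\Pi_{t;t+\Delta t}$ is the profit for the period: - $V_t=\kappa C_t$; - $\tilde V_t = V_t\frac{M_t-\Delta t}{M_t}$; - $V_{t+\Delta t}=V_t+\kappa\,\Pi_{t;t+\Delta t}$; - $\sigma_{t+\Delta t}=\sigma_t+\lambda(V_{t+\Delta t}-\tilde V_t)$; - $\Pi_{t;t+\Delta t}=\frac{V_t}{M_t}\left(R_{t;t+\Delta t}-\sigma_t\right)\Delta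 t+\tilde V_t(\sigma_{t+\Delta t}-\sigma_t)$; - $M_{t+\Delta t}=\frac{\tilde V_t(M_t-\Delta t)+(V_{t+\Delta t}-\tilde V_t)T}{V_{t+\Delta t}}$; - $C_{t+\Delta t}=C_t+\Pi_{t;t+\Delta t}$.
   Formalization: Two misprints are corrected: the capital formula uses the old mark σ_t in place of σ_{t+Δt}, and the denominator of the mark formula has its sign reversed, M_t − C_tκ²λ(M_t−Δt); M_t, V_{t+Δt} and this denominator are assumed nonzero. *)

(* Defs.v *)
From mathcomp Require Import all_boot all_order all_algebra.

Set Implicit Arguments.
Unset Strict Implicit.
Unset Printing Implicit Defensive.

Import Order.TTheory GRing.Theory Num.Theory.
Local Open Scope ring_scope.

(** Time is a grid: the index [t : nat] stands for the date [t * dt], and [t.+1]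
    for the date one step later.  All processes are given along one fixed, but
    arbitrary, scenario; [realized a b] is the realized value [R_{a;b}] of the
    period between the dates of index [a] and [b]. *)

Section Model.
Variable R : realFieldType.
Implicit Types (dt T kappa lambda : R) (realized : nat -> nat -> R).
Implicit Types (C M sigma V : nat -> R).

(** The terminal payoff [N (R_{0;T} - K)] is the sum of the per-period payoffs.
    [n] is the number of steps up to the maturity [T], and [s] is the inception
    date, the time origin of the contract: the fund trades new contracts of
    maturity [T] at every date. *)
Definition decomposable dt T realized : Prop :=
  exists n : nat, [/\ (0 < n)%N, T = n%:R * dt &
    forall (s : nat) (N K : R),
      N * (realized s (s + n)%N - K) =
      \sum_(s <= u < s + n) N * dt / T * (realized u u.+1 - K)].

Definition constant_exposure kappa C V : Prop :=
  forall t, V t = kappa * C t.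

(** The term structure is flat, so that a single implied mark [sigma t] applies
    to all maturities; [bought t] is the exposure purchased between [t] and
    [t.+1], negative if sold. *)
Definition linear_impact lambda sigma (bought : nat -> R) : Prop :=
  forall t, sigma t.+1 = sigma t + lambda * bought t.

Definition aged dt M V (t : nat) : R := V t * ((M t - dt) / M t).

(** Realized profit plus implied profit over the period from [t] to [t.+1]. *)
Definition profit dt realized M sigma V (t : nat) : R :=
  V t / M t * (realized t t.+1 - sigma t) * dt
  + aged dt M V t * (sigma t.+1 - sigma t).

(** The rebalancing trade is made in new contracts of maturity [T], so the new
    average maturity is the exposure-weighted mean of [M t - dt] and [T].
    [fund_exposure] follows from [fund_constant] and [fund_capital]. *)
Record constant_exposure_fund dt T kappa lambda realized C M sigma V : Prop :=
  ConstantExposureFund {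
    fund_constant : constant_exposure kappa C V;
    fund_exposure : forall t,
      V t.+1 = V t + kappa * profit dt realized M sigma V t;
    fund_impact :
      linear_impact lambda sigma (fun t => V t.+1 - aged dt M V t);
    fund_maturity : forall t,
      M t.+1 = (aged dt M V t * (M t - dt) + (V t.+1 - aged dt M V t) * T)
               / V t.+1;
    fund_capital : forall t, C t.+1 = C t + profit dt realized M sigma V t
  }.

End Model.

(* Main.v *)
Require Import Defs.
From mathcomp Require Import all_boot all_order all_algebra.
From mathcomp Require Import ring.

Set Implicit Arguments.
Unset Strict Implicit.
Unset Printing Implicit Defensive.

Import Order.TTheory GRing.Theory Num.Theory.
Local Open Scope ring_scope.

(** Rebalancing feeds back on itself: the period's profit depends on the new mark, the mark on the
    trade, and the trade on the profit. The loop is affine in the profit, so one linear equation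
    determines it; substituting its solution into the capital, maturity and impact relations gives
    the three closed forms. *)

Theorem theorem1 (R : realFieldType) (dt T kappa lambda : R)
    (realized : nat -> nat -> R) (C M sigma V : nat -> R)
    (dt_gt0 : 0 < dt)
    (Hdec : decomposable dt T realized)
    (Hfund : constant_exposure_fund dt T kappa lambda realized C M sigma V)
    (t : nat)
    (M_neq0 : M t != 0)
    (V_neq0 : V t.+1 != 0)
    (D_neq0 : M t - C t * kappa ^+ 2 * lambda * (M t - dt) != 0) :
  [/\ C t.+1 =
        C t + C t * kappa * dt
                * (realized t t.+1 - sigma t
                   + C t * kappa * lambda * ((M t - dt) / M t))
              / (M t - C t * kappa ^+ 2 * lambda * (M t - dt)),
      M t.+1 =
        (M t * T * dt * (kappa * (sigma t - realized t t.+1) - 1)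
         - (M t - dt) ^+ 2 * (M t - C t * kappa ^+ 2 * lambda * (M t - dt)))
        / (C t * kappa ^+ 2 * lambda * (M t - dt) ^+ 2
           - M t * (M t - kappa * dt * (sigma t - realized t t.+1)))
    & sigma t.+1 =
        (sigma t * M t
         + C t * kappa * lambda
           * (dt - kappa * sigma t * M t + kappa * dt * realized t t.+1))
        / (M t - C t * kappa ^+ 2 * lambda * (M t - dt))].
Proof.
case: Hfund => HV HE Himp Hmat Hcap.
have := erefl (profit dt realized M sigma V t).
move: (HE t) (Hmat t) (Hcap t) V_neq0.
(* Only the right side of the reflexive equation is unfolded, so [PE] expresses [P] in terms of
   itself. *)
rewrite {4}/profit (Himp t) /aged; set P := profit _ _ _ _ _ _.
move=> VS -> ->; rewrite {}VS (HV t) => V_neq0 PE.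
set D := M t - _ in D_neq0 *.
(* The new mark depends on the profit through the rebalancing trade, so [PE] is
   a linear equation in [P]; once collected, the coefficient of [P] is [D / M t]. *)
have PD : P = C t * kappa * dt * (realized t t.+1 - sigma t
                + C t * kappa * lambda * ((M t - dt) / M t)) / D.
  apply: (mulIf D_neq0); rewrite mulfVK //; apply: subr0_eq.
  (* Zero is written as [P - P] so that [PE] can replace the second [P] alone. *)
  transitivity ((P - P) * M t); last by rewrite subrr mul0r.
  by rewrite {3}PE /D; field.
split; first by rewrite PD.
- set Den := (X in _ = _ / X).
  (* Hence [Den] vanishes only if [V t.+1] does. *)
  have VDen : M t * D * (kappa * C t + kappa * P) = - (kappa * C t) * Den.
    by rewrite PD /Den /D; field; rewrite -/D D_neq0.
  have : - (kappa * C t) * Den != 0 by rewrite -VDen !mulf_neq0.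
  rewrite mulf_eq0 oppr_eq0 negb_or => /andP[kC_neq0 Den_neq0].
  (* The new exposure, the divisor in the maturity relation, is put in a form showing [Den] as a
     factor, so [field] only asks for factors known to be nonzero. *)
  have VE : kappa * C t + kappa * P = - (kappa * C t) * Den / (M t * D).
    by rewrite -VDen [RHS]mulrC mulKf // mulf_neq0.
  rewrite VE.
  move: kC_neq0; rewrite mulf_eq0 negb_or => /andP[k_neq0 C_neq0].
  rewrite /Den /D; field.
  by rewrite -/D -/Den k_neq0 C_neq0 M_neq0 D_neq0 Den_neq0.
- by rewrite PD /D; field; rewrite -/D D_neq0.
Qed.
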